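(* Let $Q\in K[x]$ be a monic irreducible polynomial and choose a root $a\in\overline K$ of $Q$ such that $\mu(x-a)=\delta(Q)$. Then $Q$ is a key polynomial for $\nu$ if and only if $(a,\delta(Q))$ is a minimal pair for $\nu$. Moreover, $(a,\delta(Q))$ is a minimal pair of definition for $\nu$ if and only if $\nu=\nu_Q$.
   Context: Setting: $K$ is a field and $\nu:K[x]\to\Gamma\cup\{\infty\}$ is a valuation on the polynomial ring in one indeterminate, with $\Gamma$ a totally ordered abelian group, i.e. $\nu(fg)=\nu(f)+\nu(g)$, $\nu(f+g)\ge\min\{\nu(f),\nu(g)\}$, $\nu(1)=0$, $\nu(0)=\infty$. It is assumed that the support of $\nu$ is zero, i.e. $\nu(f)=\infty$ only for $f=0$. $\overline K$ is a fixed algebraic closure of $K$ and $\mu$ is a fixed valuation on $\overline K[x]$ extending $\nu$. Quotients of values by positive integers are taken in the divisible hull of the value group. $\delta$: for a monic nonconstant $f\in K[x]$, $\delta(f):=\max\{\mu(x-a)\mid a\in\overline K \text{ is a root of } f\}$. Formal derivatives: for $f\in K[x]$ and $r\ge 0$, $\partial_r f\in K[x]$ is the uniquely determined polynomial such that $f(x+y)=\sum_{i=0}^{\deg f}\partial_i f(x)\,y^i$ with $y$ an independent variable ($\partial_r f=0$ for $r>\deg f$). Level: for nonzero $f\in K[x]$, $\epsilon(f):=\max_{r\ge 1}\left\{\frac{\nu(f)-\nu(\partial_r f)}{r}\right\}$, where terms with $\partial_r f=0$ are read as $-\infty$ (so $\epsilon(f)=-\infty$ for $f$ a nonzero constant).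 Key polynomial: a monic nonconstant $Q\in K[x]$ is a key polynomial for $\nu$ (of level $\epsilon(Q)$) if for every nonzero $f\in K[x]$, $\epsilon(f)\ge\epsilon(Q)$ implies $\deg(f)\ge\deg(Q)$. Minimal pairs: a minimal pair for $\nu$ is a pair $(a,\delta)\in\overline K\times\mu(\overline K[x])$ such that for every $b\in\overline K$, if $\mu(b-a)\ge\delta$ then $[K(b):K]\ge[K(a):K]$. If in addition $\mu(x-a)=\delta\ge\mu(x-b)$ for every $b\in\overline K$, then $(a,\delta)$ is called a minimal pair of definition for $\nu$. Truncation: for a nonconstant $q\in K[x]$, every $p\in K[x]$ has a unique $q$-expansion $p=p_0+p_1q+\cdots+p_nq^n$ with each $p_i\in K[x]$ zero or of degree $<\deg(q)$; the $q$-truncation of $\nu$ is the map $\nu_q(p):=\min_{0\le i\le n}\{\nu(p_iq^i)\}$.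
   Formalization: The ''Moreover'' equivalence is proved for Q a key polynomial; without this it fails: for trivial ν and μ on ℚ[x] and Q = x²+1, ν = ν_Q but (a, δ(Q)) is not a minimal pair. ''Minimal pair of definition implies ν = ν_Q'' still follows for every Q, by the first part. *)

(* Defs.v *)
From HB Require Import structures.
From mathcomp Require Import all_boot all_order ssralg orderedzmod.

Set Implicit Arguments.
Unset Strict Implicit.
Unset Printing Implicit Defensive.

Import Order.TTheory GRing.Theory.
Local Open Scope ring_scope.

(* Totally ordered abelian groups. Hierarchy-Builder requires this structure
   to be declared before the numeric structures above orderedzmod are loaded. *)

HB.mixin Record Zmodule_isOrderedGroup G
    of Order.Total ring_display G & GRing.Zmodule G := {
  ogroup_lerD2l : forall z x y : G, x <= y -> z + x <= z + y
}.

#[short(type="orderedGroupType")]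
HB.structure Definition OrderedGroup :=
  { G of Zmodule_isOrderedGroup G & Order.Total ring_display G
       & GRing.Zmodule G }.

From mathcomp Require Import all_algebra ring.
From mathcomp Require Import generic_quotient boolp classical_sets.

Local Open Scope quotient_scope.

Section OrderedGroupTheory.
Variable G : orderedGroupType.
Implicit Types x y z : G.

Lemma og_lerD2l z x y : (z + x <= z + y) = (x <= y).
Proof.
apply/idP/idP => [h|]; last exact: ogroup_lerD2l.
by rewrite -(addKr z x) -(addKr z y) ogroup_lerD2l.
Qed.

Lemma og_lerD2r z x y : (x + z <= y + z) = (x <= y).
Proof. by rewrite ![_ + z]addrC og_lerD2l. Qed.

Lemma og_ltrD2l z x y : (z + x < z + y) = (x < y).
Proof. by rewrite !ltNge og_lerD2l. Qed.

Lemma og_lerD x y z t : x <= y -> z <= t -> x + z <= y + t.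
Proof.
by move=> h k; apply: (@le_trans _ _ (y + z)); rewrite ?og_lerD2r ?og_lerD2l.
Qed.

Lemma og_ltrMn x y n : (0 < n)%N -> x < y -> x *+ n < y *+ n.
Proof.
case: n => // n _ h; elim: n => // n IHn; rewrite !(mulrS _ n.+1).
by apply: (@lt_le_trans _ _ (x + y *+ n.+1));
  [rewrite og_ltrD2l | rewrite og_lerD2r ltW].
Qed.

Lemma og_lerMn x y n : (0 < n)%N -> (x *+ n <= y *+ n) = (x <= y).
Proof.
move=> n0; case: (leP x y) => [|h].
  by rewrite le_eqVlt => /predU1P[->|h]; rewrite ?lexx // ltW // og_ltrMn.
by apply/negbTE; rewrite -ltNge og_ltrMn.
Qed.

Lemma og_mulIrn n x y : (0 < n)%N -> x *+ n = y *+ n -> x = y.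
Proof.
move=> n0 e; apply/eqP.
by rewrite eq_le -(og_lerMn x y n0) -(og_lerMn y x n0) e lexx.
Qed.

End OrderedGroupTheory.

(* Divisible hull: the fractions g/n with n > 0, where g/m = h/n if and only
   if n g = m h. The pair (g, n) : G * nat stands for g / (n + 1), so that
   denominators are positive. *)

Section DivisibleHull.
Variable G : orderedGroupType.
Implicit Types x y z : G * nat.

Definition hull_eqv x y := x.1 *+ y.2.+1 == y.1 *+ x.2.+1.

Lemma hull_eqv_refl : reflexive hull_eqv.
Proof. by move=> x; rewrite /hull_eqv. Qed.

Lemma hull_eqv_sym : symmetric hull_eqv.
Proof. by move=> x y; rewrite /hull_eqv eq_sym. Qed.

Lemma hull_eqv_trans : transitive hull_eqv.
Proof.
move=> y x z /eqP e1 /eqP e2; apply/eqP/(@og_mulIrn _ y.2.+1) => //.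
by rewrite mulrnAC e1 mulrnAC e2 mulrnAC.
Qed.

Canonical hull_equivRel :=
  EquivRel hull_eqv hull_eqv_refl hull_eqv_sym hull_eqv_trans.

Definition divhull := {eq_quot hull_eqv}.

HB.instance Definition _ : EqQuotient _ hull_eqv divhull :=
  EqQuotient.on divhull.
HB.instance Definition _ := Choice.on divhull.

Implicit Types u v w : divhull.

(* g / n; only meaningful for n > 0 *)
Definition hull_div (g : G) (n : nat) : divhull := \pi_divhull (g, n.-1).

Definition hull_addf x y : G * nat :=
  (x.1 *+ y.2.+1 + y.1 *+ x.2.+1, (x.2.+1 * y.2.+1).-1).
Definition hull_oppf x : G * nat := (- x.1, x.2).

Definition hull_add u v : divhull := \pi_divhull (hull_addf (repr u) (repr v)).
Definition hull_opp u : divhull := \pi_divhull (hull_oppf (repr u)).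
Definition hull_le u v :=
  (repr u).1 *+ (repr v).2.+1 <= (repr v).1 *+ (repr u).2.+1.

Lemma hull_piP x y :
  reflect (x.1 *+ y.2.+1 = y.1 *+ x.2.+1) (\pi_divhull x == \pi_divhull y).
Proof. by rewrite eqmodE; apply: eqP. Qed.

Lemma hull_repr x :
  (repr (\pi_divhull x)).1 *+ x.2.+1 = x.1 *+ (repr (\pi_divhull x)).2.+1.
Proof. by apply/hull_piP; rewrite reprK. Qed.

Lemma hull_addf_num x y :
  (hull_addf x y).1 = x.1 *+ y.2.+1 + y.1 *+ x.2.+1.
Proof. by []. Qed.

Lemma hull_addf_den x y : (hull_addf x y).2.+1 = (x.2.+1 * y.2.+1)%N.
Proof. by []. Qed.

Lemma hull_add_pi x y :
  hull_add (\pi_divhull x) (\pi_divhull y) = \pi_divhull (hull_addf x y).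
Proof.
apply/eqP/hull_piP; rewrite !hull_addf_num !hull_addf_den.
have := hull_repr x; have := hull_repr y.
move: (repr _) (repr _) => [x1 n'] [y1 m']; case: x y => x n [y m] ey ex.
rewrite /= in ex ey *.
rewrite !mulrnDl -!mulrnA; congr (_ + _).
  have -> : (m'.+1 * (n.+1 * m.+1) = n.+1 * (m'.+1 * m.+1))%N by ring.
  by rewrite mulrnA ex -mulrnA; congr (_ *+ _); ring.
have -> : (n'.+1 * (n.+1 * m.+1) = m.+1 * (n'.+1 * n.+1))%N by ring.
by rewrite mulrnA ey -mulrnA; congr (_ *+ _); ring.
Qed.

Lemma hull_opp_pi x : hull_opp (\pi_divhull x) = \pi_divhull (hull_oppf x).
Proof. by apply/eqP/hull_piP; rewrite /= !mulNrn hull_repr. Qed.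

Lemma hull_le_pi x y :
  hull_le (\pi_divhull x) (\pi_divhull y) = (x.1 *+ y.2.+1 <= y.1 *+ x.2.+1).
Proof.
rewrite /hull_le; have := hull_repr x; have := hull_repr y.
move: (repr _) (repr _) => [x1 n'] [y1 m']; case: x y => x n [y m] /= ey ex.
rewrite -(@og_lerMn _ _ _ (n.+1 * m.+1)) //.
rewrite -(@og_lerMn _ (x *+ _) _ (n'.+1 * m'.+1)) // -!mulrnA.
congr (_ <= _).
  have -> : (m'.+1 * (n.+1 * m.+1) = n.+1 * (m'.+1 * m.+1))%N by ring.
  by rewrite mulrnA ex -mulrnA; congr (_ *+ _); ring.
have -> : (n'.+1 * (n.+1 * m.+1) = m.+1 * (n'.+1 * n.+1))%N by ring.
by rewrite mulrnA ey -mulrnA; congr (_ *+ _); ring.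
Qed.

Lemma hull_addA : associative hull_add.
Proof.
elim/quotW=> x; elim/quotW=> y; elim/quotW=> z.
rewrite (hull_add_pi y z) (hull_add_pi x y) !hull_add_pi.
apply/eqP/hull_piP; rewrite !(hull_addf_num, hull_addf_den).
rewrite mulnA; congr (_ *+ _).
by rewrite !mulrnDl -!mulrnA addrA; congr (_ + _ *+ _ + _ *+ _); apply: mulnC.
Qed.

Lemma hull_addC : commutative hull_add.
Proof.
elim/quotW=> x; elim/quotW=> y; rewrite !hull_add_pi.
by rewrite /hull_addf addrC mulnC.
Qed.

Lemma hull_add0 : left_id (\pi_divhull (0, 0%N)) hull_add.
Proof.
elim/quotW=> x; rewrite hull_add_pi; apply/eqP/hull_piP.
by rewrite hull_addf_num hull_addf_den mul0rn add0r mulr1n mul1n.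
Qed.

Lemma hull_addN : left_inverse (\pi_divhull (0, 0%N)) hull_opp hull_add.
Proof.
elim/quotW=> x; rewrite hull_opp_pi hull_add_pi; apply/eqP/hull_piP.
by rewrite hull_addf_num mulNrn addNr !mul0rn.
Qed.

HB.instance Definition _ :=
  GRing.isZmodule.Build divhull hull_addA hull_addC hull_add0 hull_addN.

Lemma hull_le_refl : reflexive hull_le.
Proof. by move=> u; rewrite /hull_le. Qed.

Lemma hull_le_anti : antisymmetric hull_le.
Proof.
elim/quotW=> x; elim/quotW=> y; rewrite !hull_le_pi -eq_le => /eqP e.
exact/eqP/hull_piP.
Qed.

Lemma hull_le_trans : transitive hull_le.
Proof.
elim/quotW=> y; elim/quotW=> x; elim/quotW=> z; rewrite !hull_le_pi => h1 h2.
rewrite -(@og_lerMn _ _ _ y.2.+1) //.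
rewrite mulrnAC (@le_trans _ _ (y.1 *+ x.2.+1 *+ z.2.+1)) ?og_lerMn //.
by rewrite mulrnAC [leRHS]mulrnAC og_lerMn.
Qed.

HB.instance Definition _ :=
  Order.Le_isPOrder.Build ring_display divhull
    hull_le_refl hull_le_anti hull_le_trans.

Lemma hull_le_total : total (<=%O : rel divhull).
Proof.
elim/quotW=> x; elim/quotW=> y; rewrite -![(_ <= _)%O]/(hull_le _ _).
by rewrite !hull_le_pi le_total.
Qed.

HB.instance Definition _ :=
  Order.POrder_isTotal.Build ring_display divhull hull_le_total.

Lemma hull_lerD2l w u v : u <= v -> w + u <= w + v.
Proof.
elim/quotW: w => z; elim/quotW: u => x; elim/quotW: v => y.
rewrite -![_ + _]/(hull_add _ _) -![(_ <= _)%O]/(hull_le _ _).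
rewrite !hull_add_pi !hull_le_pi !hull_addf_num !hull_addf_den => h.
rewrite !mulrnDl -!mulrnA; apply: og_lerD.
  by rewrite mulnCA [leRHS](_ : _ = z.1 *+ (x.2.+1 * (z.2.+1 * y.2.+1))) ?lexx;
     [rewrite mulnCA (mulnCA x.2.+1) (mulnC x.2.+1) lexx | congr (_ *+ _); ring].
have e (m n : nat) : (m * (m * n) = n * (m * m))%N by ring.
by rewrite !e !mulrnA og_lerMn // og_lerMn.
Qed.

HB.instance Definition _ :=
  Zmodule_isOrderedGroup.Build divhull hull_lerD2l.

Lemma hull_div_le (g h : G) m n : (0 < m)%N -> (0 < n)%N ->
  (hull_div g m <= hull_div h n) = (g *+ n <= h *+ m).
Proof.
move=> m0 n0; rewrite -[LHS]/(hull_le _ _) /hull_div hull_le_pi /=.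
by rewrite !prednK.
Qed.

Lemma hull_divD (g h : G) n : hull_div (g + h) n = hull_div g n + hull_div h n.
Proof.
rewrite -[RHS]/(hull_add _ _) hull_add_pi; apply/eqP/hull_piP.
by rewrite hull_addf_num hull_addf_den /= -mulrnDl -mulrnA.
Qed.

Lemma hull_divMn (g : G) n k : (0 < n)%N -> hull_div g n *+ k = hull_div (g *+ k) n.
Proof.
move=> n0; elim: k => [|k IHk]; last by rewrite !mulrS IHk hull_divD.
by apply/esym/eqP/hull_piP; rewrite /= !mulr0n !mul0rn.
Qed.

Lemma hull_divK (g : G) n : (0 < n)%N -> hull_div g n *+ n = hull_div g 1.
Proof.
move=> n0; rewrite hull_divMn //; apply/eqP/hull_piP.
by rewrite /= prednK // mulr1n.
Qed.

End DivisibleHull.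

(* G together with a greatest element \top, absorbing for the addition (None). *)

Definition with_top (G : Type) : Type := option G.
HB.instance Definition _ (G : choiceType) := Choice.on (with_top G).

Section WithTop.
Variable G : orderedGroupType.
Implicit Types u v w : with_top G.

Definition top_add u v : with_top G :=
  if (u, v) is (Some x, Some y) then Some (x + y) else None.

Lemma top_addA : associative top_add.
Proof. by move=> [x|] [y|] [z|] //=; rewrite /top_add addrA. Qed.

Lemma top_addC : commutative top_add.
Proof. by move=> [x|] [y|] //=; rewrite /top_add addrC. Qed.

Lemma top_add0 : left_id (Some 0) top_add.
Proof. by move=> [x|] //=; rewrite /top_add add0r. Qed.

HB.instance Definition _ :=
  GRing.isNmodule.Build (with_top G) top_addA top_addC top_add0.

Definition top_le u v :=
  match u, v with _, None => true | None, _ => false | Some x, Some y => x <= y end.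

Lemma top_le_refl : reflexive top_le.
Proof. by case=> [x|] /=. Qed.

Lemma top_le_anti : antisymmetric top_le.
Proof. by move=> [x|] [y|] //= /le_anti ->. Qed.

Lemma top_le_trans : transitive top_le.
Proof. by move=> [y|] [x|] [z|] //=; apply: le_trans. Qed.

HB.instance Definition _ :=
  Order.Le_isPOrder.Build ring_display (with_top G)
    top_le_refl top_le_anti top_le_trans.

Lemma top_le_total : total (<=%O : rel (with_top G)).
Proof.
by move=> [x|] [y|] //; rewrite -![(_ <= _)%O]/(top_le _ _) /= le_total.
Qed.

HB.instance Definition _ :=
  Order.POrder_isTotal.Build ring_display (with_top G) top_le_total.

Lemma top_lex1 u : (u <= (None : with_top G))%O.
Proof. by case: u. Qed.

HB.instance Definition _ :=
  Order.hasTop.Build ring_display (with_top G) top_lex1.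

End WithTop.

(* T together with a least element \bot (None). *)

Definition with_bot (T : Type) : Type := option T.
HB.instance Definition _ (T : choiceType) := Choice.on (with_bot T).

Section WithBot.
Variable T : orderType ring_display.
Implicit Types u v w : with_bot T.

Definition bot_le u v :=
  match u, v with None, _ => true | _, None => false | Some x, Some y => x <= y end.

Lemma bot_le_refl : reflexive bot_le.
Proof. by case=> [x|] /=. Qed.

Lemma bot_le_anti : antisymmetric bot_le.
Proof. by move=> [x|] [y|] //= /le_anti ->. Qed.

Lemma bot_le_trans : transitive bot_le.
Proof. by move=> [y|] [x|] [z|] //=; apply: le_trans. Qed.

HB.instance Definition _ :=
  Order.Le_isPOrder.Build ring_display (with_bot T)
    bot_le_refl bot_le_anti bot_le_trans.

Lemma bot_le_total : total (<=%O : rel (with_bot T)).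
Proof.
by move=> [x|] [y|] //; rewrite -![(_ <= _)%O]/(bot_le _ _) /= le_total.
Qed.

HB.instance Definition _ :=
  Order.POrder_isTotal.Build ring_display (with_bot T) bot_le_total.

Lemma bot_le0x u : ((None : with_bot T) <= u)%O.
Proof. by case: u. Qed.

HB.instance Definition _ :=
  Order.hasBottom.Build ring_display (with_bot T) bot_le0x.

End WithBot.

Structure valuation (R : nzRingType) (G : orderedGroupType) := Valuation {
  val_fun :> R -> with_top G;
  val_mul : forall f g, val_fun (f * g) = val_fun f + val_fun g;
  val_add : forall f g, Num.min (val_fun f) (val_fun g) <= val_fun (f + g);
  val_one : val_fun 1 = 0;
  val_zero : val_fun 0 = \top%O
}.

Section OneField.
Variables (K : fieldType) (G : orderedGroupType) (nu : valuation {poly K} G).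
Implicit Types f q p : {poly K}.

(* The Hasse derivative d_r f is f^`N(r): see nderiv_taylor. *)

Definition level_term (u v : with_top G) (r : nat) : with_bot (divhull G) :=
  if (u, v) is (Some x, Some y) then Some (hull_div (x - y) r) else \bot%O.

(* For r >= size f one has f^`N(r) = 0, so these r contribute \bot. *)
Definition level f : with_bot (divhull G) :=
  \big[Num.max / \bot%O]_(1 <= r < size f) level_term (nu f) (nu (f^`N(r))) r.

Definition key_polynomial Q : Prop :=
  [/\ Q \is monic, (1 < size Q)%N &
      forall f, f != 0 -> level Q <= level f -> (size Q <= size f)%N].

Definition qcoef q p (i : nat) : {poly K} := (p %/ q ^+ i) %% q.

Lemma size_qcoef q p i : (1 < size q)%N -> (size (qcoef q p i) < size q)%N.
Proof. by move=> q1; rewrite ltn_modp -size_poly_gt0 ltnW. Qed.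

Lemma qexpansion q p : (1 < size q)%N ->
  p = \sum_(i < size p) qcoef q p i * q ^+ i.
Proof.
move=> q1; have q0 : q != 0 by rewrite -size_poly_gt0 ltnW.
have E n : p = \sum_(i < n) qcoef q p i * q ^+ i + p %/ q ^+ n * q ^+ n.
  elim: n => [|n IHn]; first by rewrite big_ord0 add0r expr0 divp1 mulr1.
  rewrite big_ord_recr /= {1}IHn -addrA; congr (_ + _).
  rewrite /qcoef {1}(divp_eq (p %/ q ^+ n) q) divp_divl -exprSr.
  by rewrite mulrDl addrC -mulrA -exprS.
rewrite {1}(E (size p)) [p %/ _]divp_small ?mul0r ?addr0 //.
rewrite [ltnRHS]polySpred ?expf_neq0 // size_exp ltnS.
by rewrite -[leqLHS]mul1n leq_mul2r -ltnS prednK ?q1 ?orbT // ltnW.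
Qed.

(* The terms with i >= size p vanish and have value \top. *)
Definition truncation q p : with_top G :=
  \big[Num.min / \top%O]_(i < size p) nu (qcoef q p i * q ^+ i).

End OneField.

Section AlgebraicClosure.
Variables (K : fieldType) (L : closedFieldType) (iota : {rmorphism K -> L}).
Implicit Types a b c y : L.

Local Notation "p ^%iota" := (map_poly iota p) (at level 2, format "p ^%iota").

(* K(b) *)
Definition simple_ext b : set L :=
  [set y | exists p q : {poly K},
     q^%iota.[b] != 0 /\ y = p^%iota.[b] / q^%iota.[b]].

(* e is a K-basis of K(b) *)
Definition simple_ext_basis b n (e : 'I_n -> L) : Prop :=
  [/\ forall j, simple_ext b (e j),
      forall c : 'I_n -> K, \sum_j iota (c j) * e j = 0 -> forall j, c j = 0 &
      forall y, simple_ext b y -> exists c : 'I_n -> K, y = \sum_j iota (c j) * e j].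

(* [K(b) : K]; the default value 0 is only reached for b transcendental. *)
Definition simple_ext_degree b : nat :=
  xget 0%N [set n | exists e : 'I_n -> L, simple_ext_basis b e].

Lemma simple_ext_basis_uniq b m n (e : 'I_m -> L) (e' : 'I_n -> L) :
  simple_ext_basis b e -> simple_ext_basis b e' -> m = n.
Proof.
wlog suff le : m n e e' / simple_ext_basis b e -> simple_ext_basis b e' ->
    (m <= n)%N.
  by move=> h h'; apply/eqP; rewrite eqn_leq (le _ _ _ _ h h') (le _ _ _ _ h' h).
move=> [e_in e_free _] [e'_in _ e'_span].
have /choice [A AE] i : exists c : 'I_n -> K, e i = \sum_k iota (c k) * e' k.
  exact: e'_span.
rewrite leqNgt; apply/negP => lt.
pose M := \matrix_(i < m, k < n) A i k.
have : ~~ row_free M by rewrite /row_free neq_ltn (leq_ltn_trans (rank_leq_col _)).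
rewrite -kermx_eq0 => /rowV0Pn [v /sub_kermxP vM v0].
case/negP: v0; apply/eqP/rowP => i; rewrite mxE.
apply: (e_free (v 0)); transitivity (\sum_k iota ((v *m M) 0 k) * e' k).
  under eq_bigr do rewrite AE mulr_sumr.
  rewrite exchange_big /=; apply: eq_bigr => k _.
  rewrite mxE rmorph_sum mulr_suml; apply: eq_bigr => l _.
  by rewrite mxE rmorphM mulrA.
by rewrite vM big1 // => k _; rewrite mxE rmorph0 mul0r.
Qed.

Lemma simple_ext_degreeE b n (e : 'I_n -> L) :
  simple_ext_basis b e -> simple_ext_degree b = n.
Proof.
rewrite /simple_ext_degree => eb; case: xgetP => [m _ [e' e'b]|h].
  exact: simple_ext_basis_uniq e'b eb.
by case: (h n); exists e.
Qed.

Lemma simple_ext_degree_irr b (p : {poly K}) :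
  irreducible_poly p -> root p^%iota b -> simple_ext_degree b = (size p).-1.
Proof.
move=> pirr /rootP pb; have [p1 pdiv] := pirr.
have p0 : p != 0 by rewrite -size_poly_gt0 ltnW.
have bez q : ~~ (p %| q) -> exists u : {poly K}, u^%iota.[b] * q^%iota.[b] = 1.
  rewrite -irreducible_poly_coprime // => /Bezout_eq1_coprimepP [[u v] /= uv].
  exists v; have := congr1 (fun f => f^%iota.[b]) uv.
  by rewrite rmorphD !rmorphM /= hornerD !hornerM pb mulr0 add0r rmorph1 hornerC.
apply: (@simple_ext_degreeE _ _ (fun j : 'I_(size p).-1 => b ^+ j)); split.
- move=> j; exists 'X^j, 1; rewrite rmorph1 hornerC oner_neq0 divr1.
  by rewrite map_polyXn hornerXn.
- move=> c c0.
  pose q : {poly K} := \sum_j c j *: 'X^j.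
  have qj (j : 'I_(size p).-1) : q`_j = c j.
    rewrite coef_sum (bigD1 j) //= coefZ coefXn eqxx mulr1 big1 ?addr0 // => k kj.
    by rewrite coefZ coefXn eq_sym -[_ == _ :> nat]/(k == j) (negbTE kj) mulr0.
  have szq : (size q < size p)%N.
    rewrite -[size p]prednK ?size_poly_gt0 // ltnS.
    apply: (leq_trans (size_sum _ _ _)); apply/bigmax_leqP => k _.
    by apply: (leq_trans (size_scale_leq _ _)); rewrite size_polyXn.
  have qb : q^%iota.[b] = 0.
    rewrite -c0 rmorph_sum horner_sum; apply: eq_bigr => k _.
    by rewrite /= map_polyZ map_polyXn hornerZ hornerXn.
  have [q0 j|q0] := eqVneq q 0; first by rewrite -qj q0 coef0.
  have [|u] := bez q; first by rewrite gtNdvdp.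
  by rewrite qb mulr0 => /esym/eqP; rewrite oner_eq0.
- move=> y [f [g [g0 ->]]].
  have [|u ug] := bez g.
    by apply: contra g0 => /dvdpP[h ->]; rewrite rmorphM hornerM pb mulr0.
  have -> : f^%iota.[b] / g^%iota.[b] = ((f * u) %% p)^%iota.[b].
    apply: (mulIf g0); rewrite divfK //.
    have := congr1 (fun f => f^%iota.[b]) (divp_eq (f * u) p).
    rewrite [in RHS]rmorphD rmorphM /= rmorphM hornerD !hornerM pb mulr0 add0r => <-.
    by rewrite -mulrA ug mulr1.
  set r := _ %% p; have rp : (size r <= (size p).-1)%N.
    by rewrite -ltnS prednK ?size_poly_gt0 // ltn_modp.
  exists (fun j => r`_j).
  rewrite (horner_coef_wide _ (n := (size p).-1)) ?size_map_poly //.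
  by apply: eq_bigr => k _; rewrite coef_map.
Qed.

Definition root_seq (f : {poly L}) : seq L := sval (closed_field_poly_normal f).

Lemma mem_root_seq (f : {poly L}) : f != 0 -> root_seq f =i root f.
Proof.
rewrite /root_seq; case: closed_field_poly_normal => /= s fE f0 a.
rewrite -[RHS]/(root f a) [X in root X]fE rootZ ?lead_coef_eq0 //.
by rewrite root_prod_XsubC.
Qed.

Variables (G : orderedGroupType) (mu : valuation {poly L} G).

(* The maximum starts from the first of the values; \top is only reached when
   f has no root. *)
Definition delta (f : {poly K}) : with_top G :=
  let vs := [seq mu ('X - a%:P) | a <- root_seq f^%iota] in
  \big[Num.max / head \top%O vs]_(v <- vs) v.

Lemma delta_max (f : {poly K}) : (1 < size f)%N ->
  (exists2 a, root f^%iota a & delta f = mu ('X - a%:P)) /\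
  (forall a, root f^%iota a -> mu ('X - a%:P) <= delta f).
Proof.
move=> f1; have f0 : f^%iota != 0 by rewrite -size_poly_gt0 size_map_poly ltnW.
have rE := mem_root_seq f0; rewrite /delta; set vs := map _ _.
have vs0 : (0 < size vs)%N.
  rewrite size_map; case: (closed_rootP f^%iota _) => [|a].
    by rewrite size_map_poly; case: (size f) f1 => [|[]].
  by rewrite -[root _ _]rE; case: (root_seq _).
have ub v : v \in vs -> v <= \big[Num.max / head \top%O vs]_(v <- vs) v.
  by move=> vin; apply: (bigmax_sup_seq _ v).
have att : \big[Num.max / head \top%O vs]_(v <- vs) v \in vs.
  have h0 : head \top%O vs \in vs by rewrite -nth0 mem_nth.
  rewrite big_seq; elim/big_ind: _ => // x y xin yin.
  by rewrite maxEle; case: ifP.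
split=> [|a ra].
  by case/mapP: att => a; rewrite rE => ra ->; exists a.
by apply: ub; apply: map_f; rewrite rE.
Qed.

Definition minimal_pair a (d : with_top G) : Prop :=
  (exists f, mu f = d) /\
  (forall b, d <= mu (b - a)%:P -> (simple_ext_degree a <= simple_ext_degree b)%N).

Definition minimal_pair_of_definition a (d : with_top G) : Prop :=
  [/\ minimal_pair a d, mu ('X - a%:P) = d &
      forall b, mu ('X - b%:P) <= d].

End AlgebraicClosure.

(* Main.v *)
Require Import Defs.
From mathcomp Require Import all_boot all_order all_algebra ring.
From mathcomp Require Import boolp.

Set Implicit Arguments.
Unset Strict Implicit.
Unset Printing Implicit Defensive.

Import Order.TTheory GRing.Theory.
Local Open Scope ring_scope.

(** Attach to a polynomial f over L and to d in the value group the Newton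
polygon of the Taylor expansion f(x + y), seen as a polynomial in y: the points
(r, mu (f^`N(r))). The line of slope - d through the point (0, mu f) may lie
weakly below this polygon, touching it for the last time at the abscissa k;
this is the relation [supports mu d f k]. By the argument of Gauss's lemma,
applied to the Leibniz formula for Hasse derivatives, these k add up under
products of polynomials ([supportsM]). A linear factor x - c with
mu (x - c) <= d has k = 1 or k = 0 according to whether mu (x - c) = d or not.
Since L is algebraically closed, a polynomial all of whose roots c satisfy
mu (x - c) <= d is therefore supported at d, with k the number of roots, counted
with multiplicity, for which equality holds ([supports_roots]).

For d = delta f one has k > 0, and the inequalities
mu f <= mu (f^`N(r)) + r d, with equality at r = k, say that the level of f is d
([level_delta]). So comparing levels amounts to comparing the invariants delta
([level_le]). It follows that Q is a key polynomial if and only if every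
nonzero polynomial over K with a root c such that mu (x - c) >= mu (x - a) has
degree at least that of Q ([key_polynomialP]). By the ultrametric inequality
mu (x - c) >= mu (x - a) is the same as mu (c - a) >= mu (x - a), so that, with
the minimal polynomial of c for the polynomial over K, this condition also says
that (a, delta Q) is a minimal pair ([minimal_pairP]).

Now let Q be a key polynomial, d = delta Q, and let k > 0 be the number of roots
of Q at which d is reached. The roots c of a nonzero coefficient f_i of the
Q-expansion of f satisfy mu (x - c) < d, since deg f_i < deg Q; so the term
f_i Q^i is supported at d with last contact i k ([supports_qcoef]). Suppose
first that mu (x - c) <= d for all c. Then f is supported at d as well. If m is
the largest index for which the term of index m has the minimal value, then at
r = m k the derivative of this term is strictly dominant in f^`N(r), and
mu f <= mu (f^`N(r)) + r d is the value of that term: nu f is the minimum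
([nu_le_term]). Suppose conversely that nu is its own truncation. Adding the
inequalities for the terms gives mu f <= mu (f^`N(r)) + r d for all r. This
would fail for some r if f had a root c with mu (x - c) > d, because f attains
equality for the slope delta f > d; and every c in L is a root of some f
([truncationP]). *)

(** * Ordered groups with a greatest element *)

Section WithTopTheory.
Variable G : orderedGroupType.
Implicit Types (u v w t : with_top G) (x y z : G).

Lemma top_leE x y : ((Some x : with_top G) <= Some y) = (x <= y).
Proof. by []. Qed.

Lemma top_ltE x y : ((Some x : with_top G) < Some y) = (x < y).
Proof. by rewrite !ltNge top_leE. Qed.

Lemma top_addE x y : (Some x : with_top G) + Some y = Some (x + y).
Proof. by []. Qed.

Lemma top_addTl u : (\top%O : with_top G) + u = \top%O.
Proof. by []. Qed.

Lemma top_addTr u : u + (\top%O : with_top G) = \top%O.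
Proof. by rewrite addrC. Qed.

Lemma top_finP u : u < \top%O -> exists x, u = Some x.
Proof. by case: u => [x|]; [exists x | rewrite ltxx]. Qed.

Lemma top_leD2r x u v : (u + Some x <= v + Some x) = (u <= v).
Proof.
case: u v => [y|] [z|] //.
by rewrite !top_addE !top_leE og_lerD2r.
Qed.

Lemma top_ltD2r x u v : (u + Some x < v + Some x) = (u < v).
Proof. by rewrite !ltNge top_leD2r. Qed.

Lemma top_addr0 u : u + Some 0 = u.
Proof. exact: addr0. Qed.

Lemma top_leBlDr x u v : (u + Some (- x) <= v) = (u <= v + Some x).
Proof. by rewrite -(top_leD2r x (_ + _)) -addrA top_addE addNr top_addr0. Qed.

Lemma top_ltBlDr x u v : (u + Some (- x) < v) = (u < v + Some x).
Proof. by rewrite -(top_ltD2r x (_ + _)) -addrA top_addE addNr top_addr0. Qed.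

Lemma top_leD u v w t : u <= v -> w <= t -> u + w <= v + t.
Proof.
case: v t => [y|] [z|] //; try by rewrite ?top_addTl ?top_addTr lex1.
case: u w => [x|] [x'|] //; exact: og_lerD.
Qed.

Lemma top_ltD u v w t : u < v -> w <= t -> w < \top%O -> u + w < v + t.
Proof.
move=> uv wt /top_finP[x wE]; subst w.
by apply: (@lt_le_trans _ _ (v + Some x)); [rewrite top_ltD2r | apply: top_leD].
Qed.

End WithTopTheory.

(** * Valuations on a ring *)

Section ValuationTheory.
Variables (R : nzRingType) (G : orderedGroupType) (v : valuation R G).
Implicit Types (f g : R) (u : with_top G).

Lemma val_leD u f g : u <= v f -> u <= v g -> u <= v (f + g).
Proof. by move=> uf ug; apply: le_trans (val_add v f g); rewrite le_min uf. Qed.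

Lemma val_ltD u f g : u < v f -> u < v g -> u < v (f + g).
Proof. by move=> uf ug; apply: lt_le_trans (val_add v f g); rewrite lt_min uf. Qed.

Lemma val_le_sum u I (r : seq I) (P : pred I) (F : I -> R) :
  (forall i, P i -> u <= v (F i)) -> u <= v (\sum_(i <- r | P i) F i).
Proof.
move=> uF; elim/big_ind: _ => //; first by rewrite val_zero lex1.
by move=> f g; apply: val_leD.
Qed.

Lemma val_lt_sum u I (r : seq I) (P : pred I) (F : I -> R) :
  u < \top%O -> (forall i, P i -> u < v (F i)) -> u < v (\sum_(i <- r | P i) F i).
Proof.
move=> u_fin uF; elim/big_ind: _ => //; first by rewrite val_zero.
by move=> f g; apply: val_ltD.
Qed.

(** The value of -1 is a torsion element, and an ordered group has none but 0. *)
Lemma valN f : v (- f) = v f.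
Proof.
suff v_neg1 : v (-1) = 0 by rewrite -mulN1r val_mul v_neg1 add0r.
have := val_mul v (-1) (-1); rewrite mulrNN mulr1 val_one.
case: (v (-1)) => [x|] // /esym [x2_0]; congr Some.
by apply: (@og_mulIrn _ 2) => //; rewrite mul0rn.
Qed.

Lemma val_addl f g : v f < v g -> v (f + g) = v f.
Proof.
move=> fg; apply/eqP; rewrite eq_le val_leD ?andbT //; last exact: ltW.
rewrite leNgt; apply/negP => h.
suff : v f < v f by rewrite ltxx.
by rewrite -[X in _ < v X](addrK g); apply: val_ltD; rewrite ?valN.
Qed.

End ValuationTheory.

(** * The Leibniz formula for Hasse derivatives *)

Section Leibniz.
Variable R : comNzRingType.
Implicit Types p q : {poly R}.

(** By induction on p, as p * 'X + c satisfies the Pascal-type recurrence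
[nderivnMXaddC], which matches the splitting off of the first term of the sum. *)
Lemma nderivnM p q n :
  (p * q)^`N(n) = \sum_(i < n.+1) p^`N(i) * q^`N(n - i).
Proof.
elim/poly_ind: p n => [|p c IHp] n.
  by rewrite mul0r linear0 big1 // => i _; rewrite linear0 mul0r.
case: n => [|n]; first by rewrite big_ord1 !nderivn0.
have -> : (p * 'X + c%:P) * q = p * q * 'X + 0%:P + c *: q.
  by rewrite -mul_polyC polyC0 addr0 mulrDl mulrAC.
rewrite nderivnD nderivnZ nderivnMXaddC !IHp -mul_polyC.
rewrite [RHS]big_ord_recl [X in X * 'X]big_ord_recl nderivn0 /bump /= !subn0.
under [in RHS]eq_bigr => i _ do
  rewrite /bump /= add1n subSS nderivnMXaddC mulrDl (mulrAC _ 'X).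
rewrite big_split /= -mulr_suml nderivn0 !mulrDl mulrAC.
under [X in _ + (_ + X * 'X) + _]eq_bigr => i _ do rewrite /bump /= add1n subSS.
ring.
Qed.

End Leibniz.

(** * Supporting lines of the Newton polygon of f(x + y) *)

Section Supports.
Variables (L : fieldType) (G : orderedGroupType) (mu : valuation {poly L} G).
Variable d : G.
Implicit Types (f g : {poly L}) (k l r : nat).

(** The height of the point of abscissa r of the Newton polygon above the line
of slope - d through the origin. *)
Definition tilt f r : with_top G := mu (f^`N(r)) + Some (d *+ r).

(** The line of slope - d through (0, mu f) supports the Newton polygon, and k is
the abscissa of its last contact. The last contact, unlike an arbitrary one, is
unique and hence additive under products. *)
Definition supports f k :=
  [/\ forall r, mu f <= tilt f r, tilt f k = mu f
    & forall r, (k < r)%N -> mu f < tilt f r].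

Lemma supports_fin f k : supports f k -> mu f < \top%O.
Proof. by case=> _ _ /(_ k.+1 (leqnn _)) h; apply: lt_le_trans h (lex1 _). Qed.

Lemma tiltM f g r i : (i <= r)%N ->
  mu (f^`N(i) * g^`N(r - i)) + Some (d *+ r) = tilt f i + tilt g (r - i).
Proof.
move=> ir; rewrite val_mul /tilt addrACA; congr (_ + _).
by rewrite top_addE -mulrnDr subnKC.
Qed.

(** Gauss's lemma: in the Leibniz sum for the derivative of order k + l, the
product of the last contacts is the only term of minimal value, every other
pair of orders going past the last contact of f or past that of g. *)
Lemma supportsM f g k l :
  supports f k -> supports g l -> supports (f * g) (k + l).
Proof.
move=> sf sg; have [f_fin g_fin] := (supports_fin sf, supports_fin sg).
case: sf sg => [f_le f_eq f_lt] [g_le g_eq g_lt].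
have fg_fin : mu f + mu g < \top%O.
  by case/top_finP: f_fin => x ->; case/top_finP: g_fin => y ->.
have fg_lt r i : (i <= r)%N -> (k < i)%N || (l < r - i)%N ->
    mu f + mu g < mu (f^`N(i) * g^`N(r - i)) + Some (d *+ r).
  move=> ir /orP[ki|li]; rewrite tiltM //.
    by apply: top_ltD; [apply: f_lt | apply: g_le | ].
  by rewrite addrC [ltRHS]addrC; apply: top_ltD; [apply: g_lt | apply: f_le | ].
have untilt_fin r : mu f + mu g + Some (- (d *+ r)) < \top%O.
  by case/top_finP: fg_fin => x ->.
split.
- move=> r; rewrite val_mul /tilt nderivnM -top_leBlDr; apply: val_le_sum => i _.
  by rewrite top_leBlDr tiltM -1?ltnS //; apply: top_leD.
- rewrite val_mul /tilt nderivnM.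
  (* the index k stands for the product of the two last contacts *)
  have kl : (k < (k + l).+1)%N by rewrite ltnS leq_addr.
  rewrite (bigD1 (Ordinal kl)) //= val_addl.
    by rewrite tiltM ?leq_addr // addKn f_eq g_eq.
  apply: val_lt_sum.
    rewrite -(top_ltD2r (d *+ (k + l))) tiltM ?leq_addr // addKn f_eq g_eq.
    exact: fg_fin.
  move=> i; rewrite -val_eqE /= => ik.
  rewrite -(top_ltD2r (d *+ (k + l))) (@tiltM f g _ k) ?leq_addr // addKn f_eq g_eq.
  apply: fg_lt; first by rewrite -ltnS.
  have := ltn_ord i; rewrite ltnS ltn_subRL.
  by case: ltngtP ik => // ik _ _; rewrite ltn_add2r ik.
- move=> r klr; rewrite val_mul /tilt nderivnM -top_ltBlDr.
  apply: val_lt_sum => // i _; rewrite top_ltBlDr; apply: fg_lt.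
    by rewrite -ltnS.
  case: ltnP => //= ik; rewrite ltn_subRL.
  by apply: leq_ltn_trans klr; rewrite leq_add2r.
Qed.

Lemma val_polyC_fin (c : L) : c != 0 -> mu c%:P < \top%O.
Proof.
move=> c0; have := val_mul mu c%:P c^-1%:P.
by rewrite -polyCM divff // val_one; case: (mu c%:P).
Qed.

Lemma supportsC (c : L) : c != 0 -> supports c%:P 0.
Proof.
move=> /val_polyC_fin c_fin; rewrite /supports /tilt; split.
- move=> [|r]; rewrite nderivnC /= ?val_zero ?top_addTl ?lex1 //.
  by rewrite mulr0n top_addr0.
- by rewrite nderivnC /= mulr0n top_addr0.
- by move=> [|r] // _; rewrite nderivnC /= val_zero top_addTl.
Qed.

Lemma supports_XsubC (b : L) : mu ('X - b%:P) <= Some d ->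
  supports ('X - b%:P) (mu ('X - b%:P) == Some d).
Proof.
move=> bd; set f := 'X - b%:P in bd *.
have f_fin : mu f < \top%O by apply: le_lt_trans bd _.
have t0 : tilt f 0 = mu f.
  by rewrite /tilt nderivn0 mulr0n top_addr0.
have t1 : tilt f 1 = Some d.
  rewrite /tilt nderivn1 derivB derivX derivC subr0 val_one add0r.
  by rewrite mulr1n.
have t2 r : (1 < r)%N -> tilt f r = \top%O.
  by move=> r1; rewrite /tilt nderivn_poly0 ?size_XsubC // val_zero top_addTl.
split.
- by move=> [|[|r]]; rewrite ?t0 ?t1 ?t2 ?lex1.
- by case: eqP => [->|_]; rewrite ?t0 ?t1.
- case: eqP => [_|/eqP fd] [|[|r]] // _; rewrite ?t1 ?t2 //.
  by rewrite lt_neqAle fd.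
Qed.

Lemma supports_exp f k i : supports f k -> supports (f ^+ i) (i * k).
Proof.
move=> fk; elim: i => [|i IHi].
  by rewrite expr0 mul0n -polyC1; apply: supportsC; rewrite oner_eq0.
by rewrite exprS mulSn; apply: supportsM.
Qed.

End Supports.

(** Factoring f reduces the claim to constants and linear polynomials; k counts
the roots at which the bound d is reached. *)
Lemma supports_roots (L : closedFieldType) (G : orderedGroupType)
    (mu : valuation {poly L} G) (d : G) (f : {poly L}) :
  f != 0 -> (forall c, root f c -> mu ('X - c%:P) <= Some d) ->
  exists2 k, supports mu d f k &
    (0 < k)%N <-> exists2 c, root f c & mu ('X - c%:P) = Some d.
Proof.
move=> f0; have [s fE] := closed_field_poly_normal f.
have lf0 : lead_coef f != 0 by rewrite lead_coef_eq0.
have rootE : root f =1 mem s.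
  by move=> c; rewrite fE rootZ // root_prod_XsubC.
move=> s_le; pose P := [pred c | mu ('X - c%:P) == Some d].
exists (count P s); last first.
  rewrite -has_count; split=> [/hasP[c cs /eqP ?]|[c]].
    by exists c; rewrite ?rootE.
  by rewrite rootE => cs /eqP; move=> ?; apply/hasP; exists c.
have {}s_le : {in s, forall c, mu ('X - c%:P) <= Some d}.
  by move=> c cs; apply: s_le; rewrite rootE.
rewrite fE -mul_polyC -[count _ _]add0n; apply: supportsM.
  exact: supportsC.
elim: s s_le {fE rootE} => [|c s IHs] s_le.
  by rewrite big_nil -polyC1; apply: supportsC; rewrite oner_eq0.
rewrite big_cons; apply: supportsM; last first.
  by apply: IHs => b bs; apply: s_le; rewrite inE bs orbT.
by apply: supports_XsubC; apply: s_le; rewrite mem_head.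
Qed.

(** * Degrees of algebraic elements *)

Section Algebraic.
Variables (K : fieldType) (L : closedFieldType) (iota : {rmorphism K -> L}).
Implicit Types (p q f : {poly K}) (b c : L).
Local Notation "p ^%iota" := (map_poly iota p) (at level 2, format "p ^%iota").

(** Take p of least degree: if p = r q, then r or q vanishes at b, and the
factor that does has the degree of p. *)
Lemma exists_min_poly b : algebraicOver iota b ->
  exists p, [/\ irreducible_poly p, root p^%iota b &
    forall f, f != 0 -> root f^%iota b -> (size p <= size f)%N].
Proof.
move=> [p0 p0_neq0 p0b].
pose S n := `[< exists p, [/\ p != 0, root p^%iota b & size p = n] >].
have S_ex : exists n, S n by exists (size p0); apply/asboolP; exists p0.
case: (ex_minnP S_ex) => n /asboolP[p [p_neq0 pb p_size]] n_min.
have p_min f : f != 0 -> root f^%iota b -> (size p <= size f)%N.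
  by move=> f0 fb; rewrite p_size; apply: n_min; apply/asboolP; exists f.
exists p; split=> //; split.
  rewrite ltnNge; apply/negP => p_le1.
  have pE := size1_polyC p_le1; move: pb p_neq0.
  by rewrite pE map_polyC rootC fmorph_eq0 polyC_eq0 => ->.
move=> q q_neq1 /dvdpP[r pE].
have [r0 q0] : r != 0 /\ q != 0.
  by apply/andP; rewrite -negb_or -mulf_eq0 -pE.
move: pb; rewrite pE rmorphM rootM => /orP[rb|qb].
  have := p_min r r0 rb; rewrite pE size_mul //.
  move: q0 q_neq1; rewrite -size_poly_gt0; case: (size q) => [|[|m]] // _ _.
  by rewrite !addnS /= -addSn leqNgt addSn ltnS leq_addr.
have qp : q %| r * q by rewrite dvdp_mull.
by rewrite -(dvdp_size_eqp qp) eqn_leq dvdp_leq ?mulf_neq0 // -pE p_min.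
Qed.

Lemma simple_ext_degree_le b f : f != 0 -> root f^%iota b ->
  (simple_ext_degree iota b <= (size f).-1)%N.
Proof.
move=> f0 fb.
have [|p [p_irr pb p_min]] := @exists_min_poly b; first by exists f.
rewrite (simple_ext_degree_irr p_irr pb).
by have := p_min f f0 fb; case: (size p) (size f) => [|m] [|n].
Qed.

End Algebraic.

(** * Level and maximal root value *)

Section Extension.
Variables (K : fieldType) (Gamma : orderedGroupType).
Variables (nu : valuation {poly K} Gamma).
Hypothesis nu_supp : forall f, nu f = \top%O -> f = 0.
Variables (L : closedFieldType) (iota : {rmorphism K -> L}).
Hypothesis L_alg : forall z : L, algebraicOver iota z.
Variables (Gamma' : orderedGroupType) (j : {additive Gamma -> Gamma'}).
Hypothesis j_mono : {mono j : x y / x <= y}.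
Variable mu : valuation {poly L} Gamma'.
Hypothesis mu_ext : forall f, mu (map_poly iota f) = omap j (nu f).
Implicit Types (f g p q : {poly K}) (b c : L) (d : Gamma').
Local Notation "p ^%iota" := (map_poly iota p) (at level 2, format "p ^%iota").

Lemma omap_le (u v : with_top Gamma) :
  ((omap j u : with_top Gamma') <= omap j v) = (u <= v).
Proof. by case: u v => [x|] [y|] //; rewrite !top_leE j_mono. Qed.

Lemma nu_fin f : f != 0 -> exists x, nu f = Some x.
Proof.
case E: (nu f) => [x|]; first by exists x.
by rewrite (nu_supp E) eqxx.
Qed.

(** x - c divides a nonzero polynomial over K, whose value is finite. *)
Lemma mu_XsubC_fin c : exists d, mu ('X - c%:P) = Some d.
Proof.
have [p p0 /factor_theorem[q pE]] := L_alg c.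
have [x nuE] := nu_fin p0; have := mu_ext p.
rewrite pE nuE val_mul; case: (mu ('X - _)) => [d|]; first by exists d.
by rewrite top_addTr.
Qed.

Lemma delta_fin f : (1 < size f)%N -> exists d, delta iota mu f = Some d.
Proof.
move=> f1; have [[c _ ->] _] := delta_max iota mu f1.
exact: mu_XsubC_fin.
Qed.

Lemma map_poly_neq0 f : f != 0 -> f^%iota != 0.
Proof. by rewrite map_poly_eq0. Qed.

Lemma root_size_gt1 f c : f != 0 -> root f^%iota c -> (1 < size f)%N.
Proof.
move=> f0 fc; rewrite ltnNge; apply/negP => f_le1.
move: fc f0; rewrite (size1_polyC f_le1) map_polyC rootC fmorph_eq0.
by rewrite polyC_eq0 => ->.
Qed.

Lemma supports_delta f d : (1 < size f)%N -> delta iota mu f = Some d ->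
  exists2 k, (0 < k)%N & supports mu d f^%iota k.
Proof.
move=> f1 fd; have f0 : f != 0 by rewrite -size_poly_gt0 ltnW.
have [[c fc cd] c_max] := delta_max iota mu f1.
have [c' fc'|k fk k_gt0] := @supports_roots L _ mu d _ (map_poly_neq0 f0).
  by rewrite -fd c_max.
by exists k => //; apply/k_gt0; exists c; rewrite // -cd.
Qed.

(** The level of f is delta f. As these live in the divisible hull of Gamma and
in Gamma', the equality is expressed through a fraction x / k with
j x = k (delta f). The order k is a contact of the supporting line of slope
- delta f, where the maximum defining the level is reached. *)
Lemma level_delta f d : (1 < size f)%N -> delta iota mu f = Some d ->
  exists x k, [/\ (0 < k)%N, level nu f = Some (hull_div x k) & j x = d *+ k].
Proof.
move=> f1 fd; have [k k0 [f_le f_eq _]] := supports_delta f1 fd.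
have f0 : f != 0 by rewrite -size_poly_gt0 ltnW.
have [x fx] := nu_fin f0.
rewrite /tilt nderivn_map !mu_ext fx in f_eq.
case fky: (nu f^`N(k)) f_eq => [y|] // [jxy].
have jE : j (x - y) = d *+ k by rewrite raddfB /= -jxy addrC addKr.
exists (x - y), k; split=> //.
have k_size : (k < size f)%N.
  by rewrite ltnNge; apply/negP => /nderivn_poly0 E; move: fky; rewrite E val_zero.
apply/eqP; rewrite eq_le /level; apply/andP; split; last first.
  apply: (bigmax_sup_seq _ k) => //; first by rewrite mem_index_iota k0.
  by rewrite fx fky.
rewrite big_seq; apply: bigmax_le; first exact: le0x.
move=> r; rewrite mem_index_iota => /andP[r0 _]; rewrite fx /level_term.
case frz: (nu f^`N(r)) => [z|]; last exact: le0x.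
rewrite -[_ <= _]/(hull_div (x - z) r <= hull_div (x - y) k).
rewrite hull_div_le // -j_mono !raddfMn /= jE mulrnAC og_lerMn //.
have := f_le r; rewrite /tilt nderivn_map !mu_ext fx frz /= top_addE top_leE => xz.
by rewrite raddfB -(og_lerD2l (j z)) addrCA subrr addr0.
Qed.

Lemma level_le f g : (1 < size f)%N -> (1 < size g)%N ->
  (level nu f <= level nu g) = (delta iota mu f <= delta iota mu g).
Proof.
move=> f1 g1; have [d fd] := delta_fin f1; have [e ge] := delta_fin g1.
have [x [k [k0 -> jx]]] := level_delta f1 fd.
have [y [l [l0 -> jy]]] := level_delta g1 ge.
rewrite fd ge top_leE -[LHS]/(hull_div x k <= hull_div y l).
rewrite hull_div_le // -j_mono !raddfMn /= jx jy.
by rewrite (mulrnAC e) !og_lerMn.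
Qed.

Lemma level_const f : (size f <= 1)%N -> level nu f = \bot%O.
Proof. by move=> f1; rewrite /level big_geq. Qed.

(** * Key polynomials and minimal pairs *)

Section Root.
Variables (Q : {poly K}) (a : L).
Hypotheses (Q_monic : Q \is monic) (Q_irr : irreducible_poly Q).
Hypotheses (Qa : root Q^%iota a) (a_delta : mu ('X - a%:P) = delta iota mu Q).

(** The common reformulation of being a key polynomial and of being a minimal
pair: the polynomials of degree less than deg Q have no root c that is as close
to x as a is. *)
Definition no_close_root :=
  forall f c, f != 0 -> root f^%iota c ->
    mu ('X - a%:P) <= mu ('X - c%:P) -> (size Q <= size f)%N.

Let Q1 : (1 < size Q)%N := Q_irr.1.

Lemma key_polynomialP : key_polynomial nu Q <-> no_close_root.
Proof.
split=> [[_ _ Qkey] f c f0 fc ac|Qroots].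
  have f1 := root_size_gt1 f0 fc.
  apply: Qkey => //; rewrite level_le // -a_delta (le_trans ac) //.
  by have [_] := delta_max iota mu f1; apply.
split=> // f f0; have [f1|f1] := ltnP 1 (size f).
  have [[c fc fE] _] := delta_max iota mu f1.
  by rewrite level_le // fE -a_delta; apply: Qroots.
rewrite (level_const f1).
have [d Qd] := delta_fin Q1.
by have [x [k [_ -> _]]] := level_delta Q1 Qd.
Qed.

(** The ultrametric inequality, since x - a is the sum of x - c and c - a. *)
Lemma val_XsubC_close c :
  (mu ('X - a%:P) <= mu (c - a)%:P) = (mu ('X - a%:P) <= mu ('X - c%:P)).
Proof.
apply/idP/idP => h.
  have -> : 'X - c%:P = ('X - a%:P) - (c - a)%:P by rewrite polyCB; ring.
  by apply: val_leD; rewrite ?valN.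
have -> : (c - a)%:P = ('X - a%:P) - ('X - c%:P) by rewrite polyCB; ring.
by apply: val_leD; rewrite ?valN.
Qed.

Lemma minimal_pairP : minimal_pair iota mu a (mu ('X - a%:P)) <-> no_close_root.
Proof.
have degQ := simple_ext_degree_irr Q_irr Qa.
split=> [[_ amin] f c f0 fc|Qroots].
  rewrite -val_XsubC_close => /amin; rewrite degQ => Qc.
  have := leq_trans Qc (simple_ext_degree_le f0 fc).
  by have := root_size_gt1 f0 fc; case: (size f) (size Q) => [|m] [|n].
split; first by exists ('X - a%:P).
move=> c; rewrite val_XsubC_close degQ => ac.
have [p [p_irr pc _]] := exists_min_poly (L_alg c).
have p0 : p != 0 by rewrite -size_poly_gt0 ltnW //; case: p_irr.
rewrite (simple_ext_degree_irr p_irr pc).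
by have := Qroots p c p0 pc ac; case: (size p) (size Q) => [|m] [|n].
Qed.

(** * Truncations *)

Section Expansion.
Hypothesis Q_far : no_close_root.
Variables (d : Gamma') (k : nat).
Hypotheses (a_d : mu ('X - a%:P) = Some d) (k0 : (0 < k)%N).
Hypothesis Q_k : supports mu d Q^%iota k.

(** The roots of h stay strictly below d, so only the factor Q^i contributes
to the last contact. *)
Lemma supports_term (h : {poly K}) i : h != 0 -> (size h < size Q)%N ->
  supports mu d (h * Q ^+ i)^%iota (i * k).
Proof.
move=> h0 hQ; rewrite rmorphM rmorphXn /= -[X in supports _ _ _ X]add0n.
have c_lt c : root h^%iota c -> mu ('X - c%:P) < Some d.
  move=> hc; rewrite ltNge -a_d; apply: contraL hQ => ac.
  by rewrite -leqNgt (Q_far h0 hc).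
apply: supportsM; last exact: supports_exp.
have [c /c_lt /ltW //|[|l] // h_l [l_gt0 _]] :=
  @supports_roots L _ mu d _ (map_poly_neq0 h0).
by have [c /c_lt] := l_gt0 isT; rewrite lt_neqAle => /andP[/eqP].
Qed.

Let term f i := (qcoef Q f i * Q ^+ i)^%iota.

Lemma nderivn_expansion f r :
  (f^%iota)^`N(r) = \sum_(i < size f) (term f i)^`N(r).
Proof. by rewrite {1}(qexpansion f Q1) !linear_sum. Qed.

Lemma supports_qcoef f i : qcoef Q f i != 0 ->
  supports mu d (term f i) (i * k).
Proof. by move=> fi0; apply: supports_term; rewrite ?size_qcoef. Qed.

Lemma tilt_term_ge f i r : mu (term f i) <= tilt mu d (term f i) r.
Proof.
have [E|fi0] := eqVneq (qcoef Q f i) 0; last by case: (supports_qcoef fi0).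
by rewrite /term E mul0r rmorph0 /tilt linear0 val_zero.
Qed.

Lemma truncation_le f : truncation nu Q f <= nu f.
Proof.
rewrite [leRHS](congr1 nu (qexpansion f Q1)).
by apply: val_le_sum => i _; apply: bigmin_le.
Qed.

(** Let m be the last index at which the value of the terms is minimal. The last
contact m k of the term of index m lies strictly after those of the earlier
terms, which are thus strictly larger at order m k; the later terms are
strictly larger from the start. So the derivative of f of order m k has the
value of that of the term, and this bounds mu f because f too is supported
at d. *)
Lemma nu_le_term f : (forall c, mu ('X - c%:P) <= Some d) ->
  forall i : 'I_(size f), nu f <= nu (qcoef Q f i * Q ^+ i).
Proof.
move=> c_le; have [->|f0 i1] := eqVneq f 0.
  by move=> i1; rewrite /qcoef div0p mod0p mul0r.
pose F (i : 'I_(size f)) := nu (qcoef Q f i * Q ^+ i).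
have [i2 _ i2_min] := arg_minP F (isT : predT i1).
pose m : 'I_(size f) := [arg max_(i > i2 | F i <= F i2) (i : nat)].
have [m_min m_max] : F m = F i2 /\ forall i : 'I_(size f), (m < i)%N -> F m < F i.
  rewrite /m; case: arg_maxnP => //= i iE i_max.
  have FiE : F i = F i2 by apply/eqP; rewrite eq_le iE i2_min.
  split=> // i' ii'; rewrite FiE ltNge; apply/negP => /i_max.
  by rewrite leqNgt ii'.
suff : nu f <= F m by move=> /le_trans; apply; rewrite m_min i2_min.
have [m0|m_neq0] := eqVneq (qcoef Q f m) 0; first by rewrite /F m0 mul0r val_zero lex1.
have m_sup := supports_qcoef m_neq0.
have [_ m_eq _] := m_sup.
have [//|l [f_le _ _] _] := @supports_roots L _ mu d _ (map_poly_neq0 f0).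
rewrite -omap_le -!mu_ext -[leRHS]/(mu (term f m)).
apply: (le_trans (f_le (m * k)%N)).
rewrite -m_eq /tilt top_leD2r nderivn_expansion (bigD1 m) //=.
(* the term of index m dominates strictly *)
rewrite val_addl //; apply: val_lt_sum.
  rewrite -(top_ltD2r (d *+ (m * k))).
  by rewrite -/(tilt _ _ _ _) m_eq; apply: supports_fin m_sup.
move=> i; rewrite -(top_ltD2r (d *+ (m * k))).
rewrite -!/(tilt _ _ _ _) m_eq -val_eqE /= neq_ltn => /orP[im|mi].
  have FmFi : mu (term f m) <= mu (term f i).
    by rewrite /term !mu_ext omap_le; rewrite -/(F m) m_min; apply: i2_min.
  have [fi0|fi0] := eqVneq (qcoef Q f i) 0.
    rewrite /tilt /term fi0 mul0r rmorph0 linear0 val_zero top_addTl.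
    exact: supports_fin m_sup.
  have [_ _ fi_lt] := supports_qcoef fi0.
  by apply: (le_lt_trans FmFi); apply: fi_lt; rewrite ltn_pmul2r.
apply: (lt_le_trans _ (tilt_term_ge f i _)).
by rewrite ltNge /term !mu_ext omap_le -ltNge; apply: m_max.
Qed.

(** In the converse direction the bounds for the terms add up to
mu f <= mu (f^`N(r)) + r d for every f and r; a root of f above d would
contradict this at a contact r of the steeper line of slope - delta f. *)
Lemma truncationP :
  (forall c, mu ('X - c%:P) <= Some d) <-> nu =1 truncation nu Q.
Proof.
split=> [c_le f|nuE c].
  apply/eqP; rewrite eq_le truncation_le andbT /truncation.
  apply/bigmin_geP; split=> [|i _]; first exact: lex1.
  exact: nu_le_term.
rewrite leNgt; apply/negP => d_c.
have [f f0 fc] := L_alg c; have f1 := root_size_gt1 f0 fc.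
have [e fe] := delta_fin f1.
have d_e : d < e.
  rewrite -top_ltE -fe (lt_le_trans d_c) //.
  by have [_] := delta_max iota mu f1; apply.
have [r r0 [_ f_eq _]] := supports_delta f1 fe.
suff : mu f^%iota <= tilt mu d f^%iota r.
  rewrite -f_eq leNgt /tilt => /negP; apply.
  have [x] := nu_fin f0; move: f_eq; rewrite /tilt mu_ext.
  case: (mu _^`N(r)) => [y|] //; last by move=> + xE; rewrite xE.
  by rewrite !top_addE top_ltE og_ltrD2l og_ltrMn.
rewrite mu_ext nuE /tilt nderivn_expansion.
rewrite -top_leBlDr; apply: val_le_sum => i _; rewrite top_leBlDr.
apply: (le_trans _ (tilt_term_ge f i r)).
by rewrite /term mu_ext omap_le; apply: bigmin_le.
Qed.

End Expansion.

End Root.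

End Extension.

Theorem theorem1p1 (K : fieldType)
  (Gamma : orderedGroupType) (nu : valuation {poly K} Gamma)
  (nu_supp : forall f, nu f = \top%O -> f = 0)
  (L : closedFieldType) (iota : {rmorphism K -> L})
  (L_alg : forall z : L, algebraicOver iota z)
  (Gamma' : orderedGroupType) (j : {additive Gamma -> Gamma'})
  (j_mono : {mono j : x y / x <= y})
  (mu : valuation {poly L} Gamma')
  (mu_ext : forall f, mu (map_poly iota f) = omap j (nu f))
  (Q : {poly K}) (Q_monic : Q \is monic) (Q_irr : irreducible_poly Q)
  (a : L) (Qa : root (map_poly iota Q) a)
  (a_delta : mu ('X - a%:P) = delta iota mu Q) :
  (key_polynomial nu Q <-> minimal_pair iota mu a (delta iota mu Q))
  /\
  (key_polynomial nu Q ->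
     (minimal_pair_of_definition iota mu a (delta iota mu Q) <->
      nu =1 truncation nu Q)).
Proof.
have Q1 := Q_irr.1.
have keyP := key_polynomialP nu_supp L_alg j_mono mu_ext Q_monic Q_irr a_delta.
have pairP := minimal_pairP L_alg mu Q_irr Qa.
rewrite a_delta in pairP.
split; first by rewrite keyP pairP.
move=> /keyP Q_far.
have [d Qd] := delta_fin nu_supp L_alg mu_ext Q1.
have [k k0 Qk] := supports_delta Q1 Qd.
have truncP := truncationP nu_supp L_alg j_mono mu_ext Q_irr Q_far _ k0 Qk.
rewrite -truncP ?a_delta // Qd; split=> [[] //|c_le].
by split=> //; rewrite -?Qd //; apply/pairP.
Qed.
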